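(* If $\varphi\in\mathcal{L}^{\div}$ is equivalent in $\mathsf{HPAL}$ to a universal formula, then $\varphi$ is successful in $\mathsf{HPAL}$; that is, for every $a\in Ag$ the formula $\exists\neg\varphi\to[\div\varphi]\neg B_a\varphi$ is valid in the class of all Kripke models.
   Context: Language. $At$ is a countable set of atoms, $Ag$ a finite set of agents. The contraction language $\mathcal{L}^{\div}$ is given by $\varphi::=\top\mid p\mid\neg\varphi\mid\varphi\wedge\varphi\mid B_a\varphi\mid[\div\varphi]\varphi\mid\forall\varphi$ with $p\in At$, $a\in Ag$; $\exists\varphi:=\neg\forall\neg\varphi$; the other Boolean connectives are the usual abbreviations. Semantics. A Kripke model is $\mathcal{M}=(W,R,V)$ with $W\neq\emptyset$, $R_a\subseteq W\times W$ an arbitrary relation for each $a\in Ag$, $V:At\to\wp(W)$; $R_a(w)=\{v:(w,v)\in R_a\}$. Atoms and Booleans are standard; $\mathcal{M},w\vDash B_a\varphi$ iff $\mathcal{M},v\vDash\varphi$ for all $v\in R_a(w)$; $\mathcal{M},w\vDash\forall\varphi$ iff $\mathcal{M},v\vDash\varphi$ for all $v\in W$; $\mathcal{M},w\vDash[\div\varphi]\psi$ iff $\mathcal{M}^{\div\varphi},w\vDash\psi$, where $\mathcal{M}^{\div\varphi}=(W,R^{\div\varphi},V)$ with $R_a^{\div\varphi}(w)=R_a(w)\cup\{v\in W:\mathcal{M},v\vDash\neg\varphi\}$ if $\mathcal{M},w\vDash B_a\varphi$, and $R_a^{\div\varphi}(w)=R_a(w)$ otherwise. A formula is valid in a class of models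 if it is true at every world of every model in the class. $\mathsf{HPAL}$ is the logic of contraction updates over all Kripke models; two formulas $\varphi,\psi$ are equivalent in $\mathsf{HPAL}$ if $\varphi\leftrightarrow\psi$ is a theorem of it, equivalently (it is sound and complete) if $\varphi\leftrightarrow\psi$ is valid in the class of all Kripke models. A literal is an atom $p$ or its negation $\neg p$. A formula is universal if it is built only from literals, $\wedge$, $\vee$ and $B_a$ ($a\in Ag$). *)

(* Defs.v *)
From mathcomp Require Import all_boot.

Set Implicit Arguments.
Unset Strict Implicit.
Unset Printing Implicit Defensive.

Section Syntax.
Variables (At : countType) (Ag : finType).

(* [Contr phi psi] is [÷phi]psi and [All] is the universal modality. *)
Inductive form : Type :=
| Top
| Atom of At
| Neg of form
| And of form & form
| Bel of Ag & form
| Contr of form & form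
| All of form.

Definition Or phi psi : form := Neg (And (Neg phi) (Neg psi)).
Definition Imp phi psi : form := Or (Neg phi) psi.
Definition Iff phi psi : form := And (Imp phi psi) (Imp psi phi).
Definition Ex phi : form := Neg (All (Neg phi)).

Inductive literal : form -> Prop :=
| lit_pos p : literal (Atom p)
| lit_neg p : literal (Neg (Atom p)).

Inductive universal : form -> Prop :=
| univ_lit l : literal l -> universal l
| univ_and phi psi : universal phi -> universal psi -> universal (And phi psi)
| univ_or phi psi : universal phi -> universal psi -> universal (Or phi psi)
| univ_bel a phi : universal phi -> universal (Bel a phi).

End Syntax.

Arguments Top {At Ag}.
Arguments Atom {At Ag} _.

Section Semantics.
Variables (At : countType) (Ag : finType).

Record model : Type := Model {
  world :> Type;
  world_nonempty : inhabited world;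
  rel_of : Ag -> world -> world -> Prop;
  val_of : At -> world -> Prop
}.

Definition believes (M : model) (a : Ag) (X : M -> Prop) (w : M) : Prop :=
  forall v, rel_of a w v -> X v.

(* The updated model depends on the formula only through its extension [X] in
   [M]. The set of worlds is unchanged, so [world (contract X)] is convertible
   to [world M]. *)
Definition contract (M : model) (X : M -> Prop) : model :=
  @Model (world M) (world_nonempty M)
    (fun a w v => rel_of a w v \/ (believes a X w /\ ~ X v))
    (@val_of M).

Fixpoint sat (phi : form At Ag) (M : model) (w : M) {struct phi} : Prop :=
  match phi with
  | Top => True
  | Atom p => val_of p w
  | Neg phi => ~ sat phi w
  | And phi psi => sat phi w /\ sat psi w
  | Bel a phi => believes a (fun v => sat phi v) w
  | Contr phi psi => @sat psi (contract (fun v : M => sat phi v)) w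
  | All phi => forall v : M, sat phi v
  end.

Definition valid_in (C : model -> Prop) (phi : form At Ag) : Prop :=
  forall M, C M -> forall w : M, sat phi w.

(* The logic, identified with its set of theorems: by soundness and
   completeness, these are the formulas valid in the class of all models. *)
Definition HPAL : form At Ag -> Prop := valid_in (fun _ => True).

Definition equivalent (L : form At Ag -> Prop) (phi psi : form At Ag) : Prop :=
  L (Iff phi psi).

Definition successful (L : form At Ag -> Prop) (phi : form At Ag) : Prop :=
  forall a : Ag, L (Imp (Ex (Neg phi)) (Contr phi (Neg (Bel a phi)))).

End Semantics.

(* Main.v *)
(* Contraction only enlarges the accessibility relations, so the truth of a
   universal formula passes from the contracted model back to the original one.
   Hence if a believed [phi] after contracting by [phi], then a believed [phi]
   before; but in that case every world refuting [phi] became accessible, and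
   [phi] would hold at such a world after, hence also before, the contraction. *)
Require Import Defs.
From mathcomp Require Import all_boot.
From Stdlib Require Import Classical.

Lemma sat_Imp (At : countType) (Ag : finType) (M : model At Ag) (w : M)
  (phi psi : form At Ag) :
  sat (Imp phi psi) w <-> (sat phi w -> sat psi w).
Proof. by rewrite /=; tauto. Qed.

Lemma sat_Iff (At : countType) (Ag : finType) (M : model At Ag) (w : M)
  (phi psi : form At Ag) :
  sat (Iff phi psi) w <-> (sat phi w <-> sat psi w).
Proof. by rewrite /=; tauto. Qed.

(** Literals survive because the valuation is kept, and [Bel] because every old successor remains
    one. [Or] hides negations, but each disjunct lies under two of them, so monotonicity is
    preserved. *)
Lemma universal_contract (At : countType) (Ag : finType) (M : model At Ag)
  (X : M -> Prop) (psi : form At Ag) (w : M) :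
  universal psi -> @sat At Ag psi (contract X) w -> sat psi w.
Proof.
move=> Upsi.
elim: Upsi w => {psi} [l [] //|f g _ IHf _ IHg|f g _ IHf _ IHg|a f _ IHf] w /=.
- by case=> /IHf ? /IHg.
- by move=> H [nf ng]; apply: H; split=> [/IHf|/IHg].
- by move=> H v Rwv; apply/IHf/H; left.
Qed.

Theorem corollary6p2 (At : countType) (Ag : finType) (phi : form At Ag) :
  (exists2 psi : form At Ag, universal psi & equivalent (@HPAL At Ag) phi psi) ->
  successful (@HPAL At Ag) phi.
Proof.
move=> [psi Upsi eqv] a M _ w; apply/sat_Imp => exN /= Bw.
(* [N] is arbitrary: the equivalence is needed both in [M] and in its contraction. *)
have equ (N : model At Ag) (v : N) : sat phi v <-> sat psi v.
  exact/sat_Iff/eqv.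
have back (v : M) : @sat At Ag phi (contract (fun u : M => sat phi u)) v ->
    sat phi v.
  move=> /(proj1 (equ (contract _) v)) psi_v.
  by apply/equ; apply: universal_contract Upsi psi_v.
have Bphi : believes a (fun u : M => sat phi u) w.
  by move=> v Rwv; apply/back/Bw; left.
(* [Bphi] and [nphi] together make [v] a new successor of [w]. *)
by apply: exN => v nphi; apply/nphi/back/Bw; right.
Qed.
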